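(* Let $\Phi_P := \{ \mathbf{x} \in \mathbb{R}^2 \mid A\mathbf{x} - \mathbf{b} \in \mathcal{Q}^3 \}$. The objective function $f(\mathbf{x}) = x_1 + x_2$ is copositive on the recession cone $\Phi_P^\infty$.
   Context: The linear operator $A:\mathbb{R}^2\to\mathbb{R}^3$ and the vector $\mathbf{b}\in\mathbb{R}^3$ are $$A = \begin{pmatrix}0 & 0\\ 0 & 1\\ 1 & 0\end{pmatrix},\qquad \mathbf{b} = \begin{pmatrix}-1\\0\\0\end{pmatrix},$$ and the second-order cone in $\mathbb{R}^3$ is $\mathcal{Q}^3 = \{\mathbf{y} = (y_1,y_2,y_3)\in\mathbb{R}^3 \mid y_3 \ge \sqrt{y_1^2+y_2^2}\}$. For a nonempty closed convex set $K\subset\mathbb{R}^n$, the recession cone is $K^\infty = \{\mathbf{h}\in\mathbb{R}^n \mid \mathbf{x}+\lambda\mathbf{h}\in K \ \ \forall \mathbf{x}\in K,\ \forall\lambda\ge 0\}$. A linear function $f(\mathbf{x}) = \langle \mathbf{c},\mathbf{x}\rangle$ is copositive on a cone $C\subset\mathbb{R}^n$ if $f(\mathbf{x})\ge 0$ for all $\mathbf{x}\in C$. *)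

(* Defs.v *)
From HB Require Import structures.
From mathcomp Require Import all_boot all_order all_algebra.
From mathcomp Require Import classical_sets reals.

Set Implicit Arguments.
Unset Strict Implicit.
Unset Printing Implicit Defensive.

Import Order.TTheory GRing.Theory Num.Theory.
Local Open Scope classical_set_scope.
Local Open Scope ring_scope.

(* Matrix indices start at 0: the entry y_{i+1} of a column vector y is
   [y i 0], the numeral i being read in the ring structure of the ordinals. *)

(* Meaningful for K nonempty, closed and convex. *)
Definition recession_cone (R : realType) (n : nat) (K : set 'cV[R]_n) :
    set 'cV[R]_n :=
  [set h | forall x : 'cV[R]_n, K x ->
           forall lambda : R, 0 <= lambda -> K (x + lambda *: h)].

Definition copositive (R : realType) (n : nat) (f : {scalar 'cV[R]_n})
    (C : set 'cV[R]_n) : Prop :=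
  forall x : 'cV[R]_n, C x -> 0 <= f x.

Definition second_order_cone3 (R : realType) : set 'cV[R]_3 :=
  [set y | Num.sqrt (y 0 0 ^+ 2 + y 1 0 ^+ 2) <= y 2 0].
Arguments second_order_cone3 : clear implicits.

Definition opA (R : realType) : 'M[R]_(3, 2) :=
  \matrix_(i < 3, j < 2)
    nth 0 (nth [::] [:: [:: 0; 0];
                        [:: 0; 1];
                        [:: 1; 0]] i) j.

Definition vecb (R : realType) : 'cV[R]_3 :=
  \col_(i < 3) nth 0 [:: -1; 0; 0] i.

Definition PhiP (R : realType) : set 'cV[R]_2 :=
  [set x | second_order_cone3 R (opA R *m x - vecb R)].
Arguments PhiP : clear implicits.

Definition objective (R : realType) (x : 'cV[R]_2) : R := x 0 0 + x 1 0.

Fact objective_is_scalar (R : realType) : scalar (@objective R).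
Proof. by move=> a u v; rewrite /objective !mxE mulrDr addrACA. Qed.

HB.instance Definition _ (R : realType) :=
  GRing.isLinear.Build R 'cV[R]_2 R *%R (@objective R)
    (@objective_is_scalar R).

(* Main.v *)
Require Import Defs.
From mathcomp Require Import all_boot all_order all_algebra.
From mathcomp Require Import classical_sets reals.

(** A linear function that is bounded below on a nonempty set cannot decrease
    along a recession direction of that set, since following the direction far
    enough would break the bound ([copositive_recession_cone]).  Here the
    feasible set is one branch of a hyperbola together with its inside,
    [sqrt (1 + x_2^2) <= x_1], which lies in the cone [|x_2| <= x_1]; so
    [x_1 + x_2] is bounded below by [0] on it ([objective_ge0]), and the vertex
    [(1, 0)] of the branch shows that it is nonempty. *)

Set Implicit Arguments.
Unset Strict Implicit.
Unset Printing Implicit Defensive.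

Import Order.TTheory GRing.Theory Num.Theory.
Local Open Scope classical_set_scope.
Local Open Scope ring_scope.

(** On the ray from [x0] along [h], [f] is affine with slope [f h]; a negative
    slope would make it tend to minus infinity while the ray stays in [K]. *)
Lemma copositive_recession_cone (R : realType) (n : nat)
    (f : {scalar 'cV[R]_n}) (K : set 'cV[R]_n) (x0 : 'cV[R]_n) (m : R) :
  K x0 -> (forall x, K x -> m <= f x) -> copositive f (recession_cone K).
Proof.
move=> Kx0 f_ge h Kh; rewrite leNgt; apply/negP => fh_lt0.
(* At this parameter the affine function f (x0 + t *: h) equals m - 1. *)
pose t := (f x0 - m + 1) / - f h.
have t_ge0 : 0 <= t.
  by rewrite divr_ge0 ?oppr_ge0 ?(ltW fh_lt0) // addr_ge0 ?subr_ge0 ?f_ge.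
have := f_ge _ (Kh _ Kx0 _ t_ge0).
rewrite linearD linearZ /= /t invrN mulrN mulNr divfK ?lt_eqF //.
by rewrite opprD opprB addrA subrKC lerDl oppr_ge0 ler10.
Qed.

Lemma PhiPE (R : realType) (x : 'cV[R]_2) :
  PhiP R x <-> Num.sqrt (1 + x 1 0 ^+ 2) <= x 0 0.
Proof.
rewrite /PhiP /second_order_cone3 /= !mxE !big_ord_recl !big_ord0 !mxE /=.
rewrite !(mul0r, mul1r, addr0, add0r, opprK, oppr0, expr1n).
by have -> : lift ord0 ord0 = 1 :> 'I_2 by apply/val_inj.
Qed.

(** On the feasible set, [- x_2 <= |x_2| = sqrt (x_2^2) <= sqrt (1 + x_2^2) <= x_1]. *)
Lemma objective_ge0 (R : realType) (x : 'cV[R]_2) :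
  PhiP R x -> 0 <= objective x.
Proof.
move=> /PhiPE x_ge; rewrite /objective -lerBlDr sub0r.
apply: le_trans x_ge; apply: le_trans (ler_norm _) _.
by rewrite normrN -sqrtr_sqr ler_wsqrtr // lerDr ler01.
Qed.

Theorem lemma3p3 (R : realType) :
  copositive (@objective R) (recession_cone (PhiP R)).
Proof.
apply: (@copositive_recession_cone _ _ _ _ (delta_mx 0 0) 0).
  by apply/PhiPE; rewrite !mxE /= expr0n addr0 sqrtr1.
exact: objective_ge0.
Qed.
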